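(* Let $n,k$ be integers with $1<k\le n/2$. The map $\rho:\mathcal{P}_n^{n-2k}\to\mathcal{P}_n^{n-2k}$ (defined in the context) is a bijection satisfying $\mathrm{cPeak}(\rho P)=1+\mathrm{cPeak}(P)$ for all $P\in\mathcal{P}_n^{n-2k}$, with addition modulo $n$. Consequently $\phi:=\Gamma^{-1}\circ\rho\circ\Gamma$ is a bijection $\phi:\mathrm{SYT}(n-k,k)\to\mathrm{SYT}(n-k,k)$ satisfying $$\mathrm{cDes}(\phi T)=1+\mathrm{cDes}(T)$$ for all $T\in\mathrm{SYT}(n-k,k)$, with addition modulo $n$.
   Context: Let $[n]=\{1,\dots,n\}$; for $D\subseteq[n]$, $1+D\subseteq[n]$ is obtained by adding $1$ modulo $n$ to each element. Tableaux are in English notation; $T_{i,j}$ is the entry in row $i$, column $j$; $\mathrm{Des}(T)=\{i\in[n-1]:i+1\text{ is in a lower row than }i\text{ in }T\}$. For $T\in\mathrm{SYT}(n-k,k)$, $2\le k\le n/2$, $\mathrm{cDes}(T)$ is defined by $\mathrm{cDes}(T)\cap[n-1]=\mathrm{Des}(T)$ and: $n\in\mathrm{cDes}(T)$ iff $T_{2,k}=T_{2,k-1}+1$ and $T_{2,i-1}>T_{1,i}$ for every $1<i<k$. $\mathcal{P}_n$ is the set of lattice paths with $n$ steps $U=(1,1)$, $D=(1,-1)$ starting at the origin and never going below the $x$-axis; $\mathcal{P}_n^h$ is the subset of those ending at height $h$; $\mathcal{P}=\bigcup_{n\ge0}\mathcal{P}_n$, $\mathcal{P}^0=\bigcup_{n\ge0}\mathcal{P}_n^0$.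 The bijection $\Gamma:\mathrm{SYT}(n-k,k)\to\mathcal{P}_n^{n-2k}$ sends $T$ to the path whose $i$th step is $U$ if $i$ is in the first row of $T$ and $D$ otherwise. A return is a $D$ step ending on the $x$-axis. The set $\mathrm{cPeak}(P)\subseteq[n]$, for $P\in\mathcal{P}_n^{n-2k}$, consists of those $i\in[n-1]$ such that the $i$th step is $U$ and the $(i+1)$st step is $D$, together with $n$ if and only if the rightmost $D$ of $P$ is immediately preceded by another $D$ and $P$ has no returns before the rightmost $D$. The map $\rho$ is defined for $P\in\mathcal{P}_n^{n-2k}$ by four cases (paths are written as words in $U,D$; $i\ge0$): 1. If $n\in\mathrm{cPeak}(P)$, write $P=UQDDU^i$ for some path $Q$, and let $\rho P=UDQDU^i$. 2. If $n-1\in\mathrm{cPeak}(P)$, write $P=QDU^{i+1}D$ with $Q\in\mathcal{P}$, and let $\rho P=UQDDU^i$. 3. If $n-1,n\notin\mathrm{cPeak}(P)$ and the last $D$ of $P$ is immediately preceded by a $U$, then the last step of $P$ is a $U$; let $\rho P$ be obtained by moving the last step to the beginning. 4. If $n-1,n\notin\mathrm{cPeak}(P)$ and the last $D$ of $P$ is immediately preceded by a $D$, write $P=RUQDDU^i$ with $R\in\mathcal{P}^0$ and $Q\in\mathcal{P}$ (that is, the last return of $P$ not including the final $D$ occurs at the end of $R$), and let $\rho P=URDQDU^i$. *)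

(* Defs.v *)
From HB Require Import structures.
From mathcomp Require Import all_boot finmap.

Set Implicit Arguments.
Unset Strict Implicit.
Unset Printing Implicit Defensive.

(* [n] = {1, ..., n} is kept 1-based, as a finite set of natural numbers;
   i |-> (i %% n).+1 sends i < n to i + 1 and n to 1. *)
Definition cyc_shift (n : nat) (A : {fset nat}) : {fset nat} :=
  [fset (i %% n).+1 | i in A]%fset.

(* T is the sequence of its rows; the size comparison makes the shape a Young
   diagram (sh is not assumed to be nonincreasing). *)
Definition is_syt (sh : seq nat) (T : seq (seq nat)) : bool :=
  [&& shape T == sh,
      perm_eq (flatten T) (iota 1 (sumn sh)),
      all (sorted ltn) T
    & sorted (fun r s => (size s <= size r) &&
                         all (fun j => nth 0 r j < nth 0 s j) (iota 0 (size s))) T].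

Definition SYT (sh : seq nat) := {T : seq (seq nat) | is_syt sh T}.

(* 1-based *)
Definition entry (T : seq (seq nat)) (i j : nat) : nat :=
  nth 0 (nth [::] T i.-1) j.-1.

Definition row_of (T : seq (seq nat)) (x : nat) : nat :=
  find (fun r => x \in r) T.

Definition Des (n : nat) (T : seq (seq nat)) : {fset nat} :=
  [fset i in iota 1 n.-1 | row_of T i < row_of T i.+1]%fset.

Definition cDes (n k : nat) (T : SYT [:: n - k; k]) : {fset nat} :=
  let t := val T in
  if (entry t 2 k == (entry t 2 k.-1).+1)
     && all (fun i => entry t 1 i < entry t 2 i.-1) (index_iota 2 k)
  then (n |` Des n t)%fset else Des n t.

Notation U := true (only parsing).
Notation D := false (only parsing).

Definition nonneg_path (w : seq bool) : bool :=
  all (fun m => count_mem D (take m w) <= count_mem U (take m w))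
      (iota 0 (size w).+1).

Definition ends_at (h : nat) (w : seq bool) : bool :=
  count_mem U w == count_mem D w + h.

Definition Path (n h : nat) :=
  {w : n.-tuple bool | nonneg_path w && ends_at h w}.

Definition word n h (P : Path n h) : seq bool := tval (val P).
Coercion word : Path >-> seq.

(* the i-th step, 1-based *)
Definition step (w : seq bool) (i : nat) : bool := nth U w i.-1.

Definition is_return (w : seq bool) (i : nat) : bool :=
  (step w i == D) && ends_at 0 (take i w).

(* 1-based position of the rightmost D; 0 if there is none *)
Definition lastD (w : seq bool) : nat :=
  \max_(1 <= i < (size w).+1 | step w i == D) i.

Definition cPeak (w : seq bool) : {fset nat} :=
  let n := size w in
  let peaks := [fset i in iota 1 n.-1 | (step w i == U) && (step w i.+1 == D)]%fset in
  if [&& 1 < lastD w, step w (lastD w).-1 == D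
       & ~~ has (is_return w) (iota 1 (lastD w).-1)]
  then (n |` peaks)%fset else peaks.

(* The graph of rho. The decompositions of P are required only to exist; that
   they are unique, and so define a map, is left to be proved. *)
Inductive rho_rel : seq bool -> seq bool -> Prop :=
| Rho1 (P Q : seq bool) (i : nat) :
    size P \in cPeak P ->
    nonneg_path Q ->
    P = [:: U] ++ Q ++ [:: D; D] ++ nseq i U ->
    rho_rel P ([:: U; D] ++ Q ++ [:: D] ++ nseq i U)
| Rho2 (P Q : seq bool) (i : nat) :
    (size P).-1 \in cPeak P ->
    nonneg_path Q ->
    P = Q ++ [:: D] ++ nseq i.+1 U ++ [:: D] ->
    rho_rel P ([:: U] ++ Q ++ [:: D; D] ++ nseq i U)
| Rho3 (P Q : seq bool) :
    (size P).-1 \notin cPeak P -> size P \notin cPeak P ->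
    step P (lastD P).-1 = U ->
    P = Q ++ [:: U] ->
    rho_rel P ([:: U] ++ Q)
| Rho4 (P R Q : seq bool) (i : nat) :
    (size P).-1 \notin cPeak P -> size P \notin cPeak P ->
    step P (lastD P).-1 = D ->
    nonneg_path R -> ends_at 0 R -> nonneg_path Q ->
    P = R ++ [:: U] ++ Q ++ [:: D; D] ++ nseq i U ->
    rho_rel P ([:: U] ++ R ++ [:: D] ++ Q ++ [:: D] ++ nseq i U).

Definition Gamma_word (n : nat) (T : seq (seq nat)) : seq bool :=
  [seq (if i \in nth [::] T 0 then U else D) | i <- iota 1 n].

Definition Gamma_inv_rows (w : seq bool) : seq (seq nat) :=
  [:: [seq i <- iota 1 (size w) | step w i == U];
      [seq i <- iota 1 (size w) | step w i == D]].

Lemma size_Gamma_word n T : size (Gamma_word n T) == n.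
Proof. by rewrite size_map size_iota. Qed.

Lemma two_row_syt n k T : k.*2 <= n -> is_syt [:: n - k; k] T ->
  exists r s, [/\ T = [:: r; s], size r = n - k /\ size s = k,
    perm_eq (r ++ s) (iota 1 n), sorted ltn r /\ sorted ltn s &
    all (fun j => nth 0 r j < nth 0 s j) (iota 0 (size s))].
Proof.
move=> hkn /and4P[/eqP]; case: T => [|r [|s [|? ?]]] //= [sr ss].
rewrite cats0 addn0 subnK; last by rewrite (leq_trans _ hkn) // -addnn leq_addr.
move=> hp /and3P[hr hs _] /andP[/andP[_ h] _].
by exists r, s.
Qed.

Lemma count_iota_mem n m (r : seq nat) : m <= n -> uniq r ->
  {subset r <= iota 1 n} ->
  count (mem r) (iota 1 m) = count (fun x => x <= m) r.
Proof.
move=> hm ur sub; rewrite -!size_filter; apply/perm_size/uniq_perm.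
- exact/filter_uniq/iota_uniq.
- exact: filter_uniq.
move=> x; rewrite !mem_filter mem_iota add1n ltnS /= andbC.
case xr: (x \in r); last by rewrite !andbF.
by move: (sub _ xr); rewrite mem_iota => /andP[-> _]; rewrite !andbT.
Qed.

Lemma count_dominated m (r s : seq nat) : size s <= size r ->
  all (fun j => nth 0 r j < nth 0 s j) (iota 0 (size s)) ->
  count (fun x => x <= m) s <= count (fun x => x <= m) r.
Proof.
elim: s r => [|y s IH] [|x r] //= hsz /andP[hxy hall].
apply: leq_add; last first.
  apply: IH => //; move: hall; rewrite -[1]/(1 + 0) iotaDl all_map.
  by apply: sub_all.
by case: (leqP y m) => // hy; rewrite (leq_trans (ltnW hxy) hy).
Qed.

Lemma Gamma_subproof n k (hkn : k.*2 <= n) (T : SYT [:: n - k; k]) :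
  nonneg_path (Gamma_word n (val T)) && ends_at (n - k.*2) (Gamma_word n (val T)).
Proof.
case: T => T /= /(two_row_syt hkn)[r [s [-> [sr ss] hp [hr hs] hcol]]].
have sub_r : {subset r <= iota 1 n}.
  by move=> x xr; rewrite -(perm_mem hp) mem_cat xr.
have sub_s : {subset s <= iota 1 n}.
  by move=> x xr; rewrite -(perm_mem hp) mem_cat xr orbT.
have := perm_uniq hp; rewrite iota_uniq cat_uniq => /and3P[ur dis us].
have cU m : m <= n -> count_mem U (take m (Gamma_word n [:: r; s]))
    = count (fun x => x <= m) r.
  move=> hm; rewrite -map_take take_iota (minn_idPl hm) count_map.
  rewrite -(count_iota_mem hm ur sub_r); apply: eq_in_count => x _ /=.
  by case: (x \in r).
have cD m : m <= n -> count_mem D (take m (Gamma_word n [:: r; s]))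
    = count (fun x => x <= m) s.
  move=> hm; rewrite -map_take take_iota (minn_idPl hm) count_map.
  rewrite -(count_iota_mem hm us sub_s); apply: eq_in_count => x.
  rewrite mem_iota add1n ltnS => /andP[x0 xm] /=.
  have : x \in r ++ s.
    by rewrite (perm_mem hp) mem_iota x0 add1n ltnS (leq_trans xm hm).
  rewrite mem_cat; have [xr _|nxr /= ->] := boolP (x \in r); last by [].
  by apply/esym/negbTE; apply: contra dis => xs; apply/hasP; exists x.
have szw := eqP (size_Gamma_word n [:: r; s]).
have hks : k <= n - k by rewrite leq_subRL; [rewrite addnn|rewrite (leq_trans _ hkn) // -addnn leq_addr].
apply/andP; split.
  apply/allP => m; rewrite mem_iota add0n szw !ltnS /= => hm.
  by rewrite cU // cD // count_dominated // sr ss.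
rewrite /ends_at; have := cU n (leqnn n); have := cD n (leqnn n).
rewrite !take_oversize ?szw // => -> ->.
have call t : {subset t <= iota 1 n} -> count (fun x => x <= n) t = size t.
  move=> st; apply/eqP; rewrite -all_count; apply/allP => x /st.
  by rewrite mem_iota add1n ltnS => /andP[].
by rewrite !call // sr ss -addnn subnDA subnKC.
Qed.

Definition Gamma n k (hkn : k.*2 <= n) (T : SYT [:: n - k; k]) :
    Path n (n - k.*2) :=
  exist (fun w : n.-tuple bool => nonneg_path w && ends_at (n - k.*2) w)
    (Tuple (size_Gamma_word n (val T))) (Gamma_subproof hkn T).

Lemma take_stepE (w : seq bool) m : m <= size w ->
  take m w = [seq step w i | i <- iota 1 m].
Proof.
move=> hm; apply: (@eq_from_nth _ U).
  by rewrite size_takel // size_map size_iota.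
rewrite size_takel // => i hi.
by rewrite nth_take // (nth_map 0) ?size_iota // nth_iota.
Qed.

Lemma count_le_filter (w : seq bool) b m : m <= size w ->
  count (fun x => x <= m) [seq i <- iota 1 (size w) | step w i == b]
    = count_mem b (take m w).
Proof.
move=> hm; rewrite take_stepE // count_map count_filter.
rewrite -(subnKC hm) iotaD count_cat [X in _ + X](_ : _ = 0) ?addn0.
  apply: eq_in_count => x; rewrite mem_iota add1n ltnS => /andP[_ hx] /=.
  by rewrite hx.
apply/eqP; rewrite -leqn0 leqNgt -has_count; apply/hasPn => x.
by rewrite mem_iota add1n => /andP[hx _] /=; rewrite leqNgt hx.
Qed.

Lemma sorted_count_le (r : seq nat) j v : sorted ltn r -> j < size r ->
  (j < count (fun x => x <= v) r) = (nth 0 r j <= v).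
Proof.
elim: r j => [|x r IH] j //= hr hj.
have hr' := path_sorted hr.
have hlt : all (ltn x) r by apply: order_path_min hr; exact: ltn_trans.
case: (leqP x v) => hx.
  by case: j hj => [|j] hj //=; rewrite add1n ltnS IH.
rewrite add0n [count _ _](_ : _ = 0) ?ltn0; last first.
  apply/eqP; rewrite -leqn0 leqNgt -has_count; apply/hasPn => y yr.
  by rewrite /= -ltnNge (ltn_trans hx) //; exact: (allP hlt).
apply/esym/negbTE; rewrite -ltnNge; case: j hj => [|j] hj //=.
by rewrite (ltn_trans hx) //; apply: (allP hlt); exact: mem_nth.
Qed.

Lemma Gamma_inv_subproof n k (hkn : k.*2 <= n) (P : Path n (n - k.*2)) :
  is_syt [:: n - k; k] (Gamma_inv_rows P).
Proof.
case: P => -[w /= sw] hw; rewrite /word /=.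
have /andP[hpos hend] := hw.
have szw := eqP sw.
set r := [seq i <- iota 1 (size w) | step w i == U].
set s := [seq i <- iota 1 (size w) | step w i == D].
have hr : sorted ltn r by apply: sorted_filter (iota_ltn_sorted _ _); exact: ltn_trans.
have hs : sorted ltn s by apply: sorted_filter (iota_ltn_sorted _ _); exact: ltn_trans.
have call b : size [seq i <- iota 1 (size w) | step w i == b] = count_mem b w.
  rewrite -[w in RHS]take_size -count_le_filter //; apply/esym/eqP.
  rewrite -all_count; apply/allP => x.
  by rewrite mem_filter mem_iota add1n ltnS => /and3P[].
have hsum : count_mem U w + count_mem D w = n.
  rewrite -szw -(count_predC (pred1 U) w); congr (_ + _).
  by apply: eq_count; case.
have hD : count_mem D w = k.
  move: hend hsum; rewrite /ends_at => /eqP ->.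
  rewrite addnAC addnn => /(congr1 (subn^~ (n - k.*2))).
  by rewrite addnK subKn // => /double_inj.
have hU : count_mem U w = n - k by rewrite -hsum hD addnK.
have hks : k <= n - k by rewrite leq_subRL; [rewrite addnn|rewrite (leq_trans _ hkn) // -addnn leq_addr].
have hkn' : k <= n by rewrite (leq_trans hks) ?leq_subr.
apply/and4P; split.
- by rewrite /Gamma_inv_rows /shape /= !call hU hD.
- rewrite /= cats0 addn0 subnK // -szw.
  rewrite [X in _ ++ X](_ : _ = [seq i <- iota 1 (size w) | predC (fun i => step w i == U) i]).
    by rewrite perm_filterC.
  by apply: eq_filter => i /=; case: (step w i).
- by rewrite /= hr hs.
rewrite /= andbT; apply/andP; split; first by rewrite !call hU hD.
apply/allP => j; rewrite mem_iota add0n /= -/s => hj.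
rewrite ltnNge; apply/negP => hle.
set v := nth 0 s j in hle.
have vs : v \in s by exact: mem_nth.
have hv : v <= size w.
  by move: vs; rewrite mem_filter mem_iota add1n ltnS => /and3P[].
have vr : v \notin r.
  by move: vs; rewrite !mem_filter => /andP[/eqP ->].
have hjr : j < size r.
  by rewrite (leq_trans hj) // !call hU hD.
have h1 : j < count (fun x => x <= v) s by rewrite sorted_count_le.
have /allP/(_ v) := hpos; rewrite mem_iota add0n ltnS hv => /(_ isT).
rewrite -!count_le_filter // => /(leq_trans h1).
rewrite sorted_count_le // => h2.
have e : nth 0 r j = v by apply/eqP; rewrite eqn_leq h2.
by case/negP: vr; rewrite -e mem_nth.
Qed.

Definition Gamma_inv n k (hkn : k.*2 <= n) (P : Path n (n - k.*2)) :
    SYT [:: n - k; k] :=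
  exist (fun T => is_syt [:: n - k; k] T) _ (Gamma_inv_subproof hkn P).

Lemma GammaK n k (hkn : k.*2 <= n) : cancel (Gamma hkn) (Gamma_inv hkn).
Proof.
move=> T; apply: val_inj; case: T => T hT /=; rewrite /word /=.
have [r [s [eT _ hp [hr hs] _]]] := two_row_syt hkn hT; subst T.
have szw := eqP (size_Gamma_word n [:: r; s]).
have stepE x : x \in iota 1 n -> step (Gamma_word n [:: r; s]) x = (x \in r).
  rewrite mem_iota add1n ltnS => /andP[x0 xn].
  rewrite /step (nth_map 0) ?size_iota ?prednK // nth_iota ?prednK //.
  by rewrite add1n prednK //=; case: ifP.
have := perm_uniq hp; rewrite iota_uniq cat_uniq => /and3P[ur dis us].
have sb b : sorted ltn [seq i <- iota 1 n | step (Gamma_word n [:: r; s]) i == b].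
  by apply: sorted_filter (iota_ltn_sorted _ _); exact: ltn_trans.
rewrite /Gamma_inv_rows szw; congr [:: _; _].
  apply: (irr_sorted_eq ltn_trans ltnn) => // x; rewrite mem_filter.
  case xi: (x \in iota 1 n); first by rewrite stepE // andbT eqb_id.
  rewrite andbF; apply/esym/negbTE; apply: contraFN xi => xr.
  by rewrite -(perm_mem hp) mem_cat xr.
apply: (irr_sorted_eq ltn_trans ltnn) => // x; rewrite mem_filter.
case xi: (x \in iota 1 n).
  rewrite stepE // andbT; move: xi; rewrite -(perm_mem hp) mem_cat.
  have [xr _|nxr /= ->] := boolP (x \in r); last by [].
  by apply/esym/negbTE; apply: contra dis => xs; apply/hasP; exists x.
rewrite andbF; apply/esym/negbTE; apply: contraFN xi => xs.
by rewrite -(perm_mem hp) mem_cat xs orbT.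
Qed.

Lemma Gamma_invK n k (hkn : k.*2 <= n) : cancel (Gamma_inv hkn) (Gamma hkn).
Proof.
move=> P; apply: val_inj; apply: val_inj; case: P => -[w sw] hw /=.
have szw := eqP sw; rewrite /word /=.
rewrite /Gamma_word -[RHS]take_size take_stepE // szw.
apply/eq_in_map => x hx; rewrite /= mem_filter szw hx andbT.
by case: (step w x).
Qed.

(* Main.v *)
Require Import Defs.
From mathcomp Require Import all_boot finmap.
From HB Require Import structures.
From mathcomp Require Import zify.

Set Implicit Arguments.
Unset Strict Implicit.
Unset Printing Implicit Defensive.

(** Every path with at least two down steps is [v ++ D :: nseq i U] with [v]
ending in [U] or in [D]. If [v] ends in [U], then [i = 0] gives a peak at [n - 1]
and the second case, while [i > 0] leaves a final up step that the third case
moves to the front; if [v = B ++ [:: D]], then [B] ends at positive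
height and splits uniquely as [R ++ U :: Q], cut at its last visit to the axis.
So the four cases are exhaustive ([rotation_exists]), where the first and the
fourth differ only in whether [R] is empty. The relation [rotation] lists the
four cases with their side conditions turned into conditions on heights, and on
paths it is equivalent to the defining relation ([rho_rel_rotation]).

All images have the form [U :: A ++ D :: nseq i U], and [A] tells the cases
apart: it starts with [D] in case 1; read from height 0, it stays nonnegative and
ends in [D] in case 2, or in [U] in case 3; in case 4 it starts with [U] and
falls below the axis, the first fall marking the end of [R]. Hence the relation
is injective ([rotation_inj]). As it preserves length and final height and the
set of paths is finite, a choice of images is a bijection; and an injective
relation that contains the graph of a surjective function is that graph, so the
value is determined by the decomposition used.

For the cyclic peaks, let [cyclic_bits w] be the indicator word of the cyclic
peak set with index 0 standing for [n]. Peaks are read off from consecutive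
letters, hence add up over concatenation, and for [U :: v ++ D :: nseq i U] the
index [n] is a cyclic peak exactly when [v] ends in [D] and stays nonnegative when
read from height 0 ([cyclic_bitsE]). With this formula the equality of the two
words up to a rotation by one place is a computation in each case
([rotation_bits]).

Finally [Gamma] carries cyclic descents to cyclic peaks ([cDes_Gamma_inv]): the
entries of the second row are the positions of the down steps, and the [j]-th
down step is a return exactly when it comes before the [j.+1]-st up step ([is_return_entry]). The statement on tableaux follows by conjugation. *)

(** * Heights of lattice words *)

(** The final height of a word read from height [h], or [None] when it goes
below the axis on the way; this makes nonnegativity and final height compose
together along concatenations. *)
Fixpoint height (h : nat) (w : seq bool) : option nat :=
  match w, h with
  | [::], _ => Some h
  | true :: w', _ => height h.+1 w'
  | false :: w', h'.+1 => height h' w'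
  | false :: _, 0 => None
  end.

Lemma height_cat h v w : height h (v ++ w) = obind (height^~ w) (height h v).
Proof. by elim: v h => [|[] v IH] [|h] //=; rewrite IH. Qed.

Lemma height_nseqU h i : height h (nseq i U) = Some (h + i).
Proof. by elim: i h => [|i IH] h /=; rewrite ?addn0 // IH addSnnS. Qed.

Lemma heightS h w m : height h w = Some m -> height h.+1 w = Some m.+1.
Proof. by elim: w h => [|[] w IH] [|h] //=; [case=> -> | case=> -> | exact: IH | exact: IH| exact: IH]. Qed.

Lemma iota1S n : iota 1 n = map S (iota 0 n).
Proof. exact: (iotaDl 1 0). Qed.

Lemma iota0S n : iota 0 n.+1 = 0 :: map S (iota 0 n).
Proof. by rewrite -iota1S. Qed.

Lemma height_count h w :
  height h w =
    if all (fun m => count_mem D (take m w) <= h + count_mem U (take m w))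
         (iota 0 (size w).+1)
    then Some (h + count_mem U w - count_mem D w) else None.
Proof.
elim: w h => [|x w IH] h; first by rewrite /= addn0 subn0.
have s0 : 0 \in iota 0 (size w).+1 by rewrite mem_head.
rewrite iota0S [size _]/=; move: (iota 0 _) s0 IH => s s0 IH; rewrite /= all_map.
case: x => /=; last case: h => [|h] //=.
  by rewrite IH add0n add1n addSnnS; congr (if _ then _ else _); apply: eq_all => m /=; lia.
by case: ifP => // /allP/(_ 0 s0); rewrite /= take0.
Qed.

Lemma nonneg_pathE w : nonneg_path w = isSome (height 0 w).
Proof. by rewrite height_count -/(nonneg_path w); case: ifP. Qed.

Lemma height0P w h : reflect (height 0 w = Some h) (nonneg_path w && ends_at h w).
Proof.
rewrite height_count -/(nonneg_path w) /nonneg_path /ends_at.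
case: ifP => [/allP/(_ (size w)) | _]; last by constructor.
rewrite mem_iota add0n ltnS leqnn take_size => /(_ isT) le_DU.
by rewrite add0n; apply: (iffP eqP) => [->|[<-]]; rewrite ?addKn ?subnKC.
Qed.

(** Read from height [h], the common word first falls below the axis right after
[R1], and also right after [R2]. *)
Lemma first_return_uniq h R1 R2 w1 w2 :
  height h R1 = Some 0 -> height h R2 = Some 0 ->
  R1 ++ D :: w1 = R2 ++ D :: w2 -> R1 = R2 /\ w1 = w2.
Proof.
elim: R1 R2 h => [|x R1 IH] [|y R2] h //=.
- by move=> _ _ [].
- by case=> -> + [ey]; rewrite -ey.
- by move=> + [eh] [ex]; rewrite eh ex.
move=> e1 e2 [exy]; subst y; case: x e1 e2 => [|]; last case: h => // h;
  move=> e1 e2 /(IH _ _ e1 e2)[-> ->] //.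
Qed.

(** [R] is the part up to the last visit to the axis. *)
Lemma last_return_split w h : height 0 w = Some h.+1 ->
  exists R Q, [/\ w = R ++ U :: Q, height 0 R = Some 0 & height 0 Q = Some h].
Proof.
elim/last_ind: w h => [|w x IH] h //; rewrite -cats1 height_cat.
case ew: (height 0 w) => [m|] //=; case: x => /= [[eh]|].
  case: h eh => [|h] em; subst m; first by exists w, [::]; rewrite ew.
  have [R [Q [-> eR eQ]]] := IH _ ew.
  by exists R, (Q ++ [:: U]); rewrite -catA eR height_cat eQ.
case: m ew => // m ew [eh]; subst m.
have [R [Q [-> eR eQ]]] := IH _ ew.
by exists R, (Q ++ [:: D]); rewrite -catA eR height_cat eQ.
Qed.

Lemma rcons_nseq (T : Type) i (x : T) : rcons (nseq i x) x = nseq i.+1 x.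
Proof. by elim: i => //= i ->. Qed.

Lemma last_down_split w : D \in w -> exists v i, w = v ++ D :: nseq i U.
Proof.
elim/last_ind: w => [|w [] IH] //; rewrite mem_rcons inE /=.
  by move/IH=> [v [i ->]]; exists v, i.+1; rewrite rcons_cat rcons_cons rcons_nseq.
by exists w, 0; rewrite cats1.
Qed.

Lemma last_down_inj v1 v2 i1 i2 :
  v1 ++ D :: nseq i1 U = v2 ++ D :: nseq i2 U -> v1 = v2 /\ i1 = i2.
Proof.
move/(congr1 rev); rewrite !rev_cat !rev_cons !rev_nseq -!cats1 -!catA.
elim: i1 i2 => [|i1 IH] [|i2] //=.
  by case=> /(can_inj revK).
by case=> /IH[-> ->].
Qed.

(** * Cyclic peaks as a cyclic word *)

Lemma stepS w i : step w i.+1 = nth U w i. Proof. by []. Qed.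

Lemma lastDE v i : lastD (v ++ D :: nseq i U) = (size v).+1.
Proof.
rewrite /lastD; apply/eqP; rewrite eqn_leq; apply/andP; split.
  elim/big_ind: _ => // [x y hx hy|[|j] hj] //; first by rewrite geq_max hx hy.
  rewrite ltnS leqNgt; move: hj; rewrite stepS nth_cat.
  case: ltnP => le_vj; first by move: le_vj; lia.
  case ed: (j - size v) => [|d] /=; first by move: le_vj ed; lia.
  by rewrite nth_nseq; case: ifP.
apply: (@leq_bigmax_seq _ _ _ id); last by rewrite stepS nth_cat ltnn subnn.
by rewrite mem_index_iota size_cat /= !ltnS addnS ltnS leq_addr.
Qed.

Definition has_return w := has (is_return w) (iota 1 (size w)).

(** Steps change the height by one, so a word falls below the axis exactly when
some down step leads to height [-1]. *)
Lemma has_below h w :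
  has (fun i => (nth U w i == D) &&
                (h.+1 + count_mem U (take i.+1 w) == count_mem D (take i.+1 w)))
    (iota 0 (size w)) = ~~ isSome (height h w).
Proof.
elim: w h => [|x w IH] h //; rewrite [size _]/= iota0S /= has_map take0 /=.
case: x => /=.
  rewrite -IH; apply: eq_has => i /=; lia.
case: h => [|h] //=; rewrite -IH; apply: eq_has => i /=; lia.
Qed.

Lemma has_return_cons w : has_return (U :: w) = ~~ isSome (height 0 w).
Proof.
rewrite -has_below /has_return [size _]/= iota1S has_map iota0S /= has_map /=.
apply: eq_has => i /=; rewrite /is_return stepS /ends_at /=; lia.
Qed.

Lemma mem_size_cPeak w : (size w \in cPeak w) =
  [&& 1 < lastD w, step w (lastD w).-1 == D
    & ~~ has (is_return w) (iota 1 (lastD w).-1)].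
Proof.
rewrite /cPeak; case: ifP => _; first by rewrite !inE eqxx.
rewrite !inE mem_iota /=; lia.
Qed.

(** Dropping the initial [U] lowers the rest by one, so that returns before the
last down step become falls of [v] below the axis. *)
Lemma cyclic_peakE v i : (size (U :: v ++ D :: nseq i U) \in cPeak (U :: v ++ D :: nseq i U)) =
  ~~ last U v && isSome (height 0 v).
Proof.
rewrite mem_size_cPeak -cat_cons lastDE /= -cat_cons ; congr (_ && _).
  elim/last_ind: v => [|v x _] //; rewrite last_rcons size_rcons.
  by rewrite /step /= nth_cat size_rcons ltnSn nth_rcons ltnn eqxx; case: x.
rewrite -[RHS]negbK -has_return_cons; congr (~~ _).
apply: eq_in_has => j; rewrite mem_iota => /andP[j0 hj].
rewrite /is_return; case: j j0 hj => // j _ hj.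
have lt_jv : j < size (U :: v) by move: hj => /=; lia.
by rewrite !stepS nth_cat lt_jv takel_cat.
Qed.

(** For [i > 0], bit [i] tells whether step [i] (counted from 1) is [U] and the
next one is [D]; in bit 0 the letter [x] takes the place of a step before [w],
which makes the bits of a concatenation a concatenation. *)
Definition peak_bits x w := pairmap (fun a b => a && ~~ b) x w.

(** Indicator word of the cyclic peaks modulo the length: index 0 stands for the
position [size w]. *)
Definition cyclic_bits w := (size w \in cPeak w) :: behead (peak_bits U w).

Lemma size_cyclic_bits w : 0 < size w -> size (cyclic_bits w) = size w.
Proof. by move=> w0; rewrite /= size_behead size_pairmap prednK. Qed.

Lemma mem_cPeakE w i : (i \in cPeak w) =
  (i == size w) && (size w \in cPeak w)
  || [&& 0 < i, i < size w, step w i == U & step w i.+1 == D].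
Proof.
rewrite /cPeak; case: ifP => _; rewrite !inE !mem_iota; move: (_ == U) (_ == D) (_ == U) (_ == D) => ? ? ? ?; lia.
Qed.

Lemma mem_cPeak w i : 0 < size w ->
  (i \in cPeak w) = (0 < i <= size w) && nth false (cyclic_bits w) (i %% size w).
Proof.
move=> w0; rewrite mem_cPeakE; case: (ltngtP i (size w)) => hi; last first.
- by subst i; rewrite w0 modnn orbF.
- by rewrite andbF.
case: i hi => [|i] hi //=; rewrite modn_small //= nth_behead.
by rewrite (nth_pairmap U) // /step /=; do 2!case: (nth _ _ _).
Qed.

Lemma cPeak_shift w w' : 0 < size w -> size w' = size w ->
  rot 1 (cyclic_bits w') = cyclic_bits w ->
  cPeak w' = cyc_shift (size w) (cPeak w).
Proof.
move=> w0 sw' bits; apply/fsetP => j; have w0' : 0 < size w' by rewrite sw'.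
have nth_bits i : i < size w ->
    nth false (cyclic_bits w) i = nth false (cyclic_bits w') (i.+1 %% size w).
  move=> hi; rewrite -bits rot1_cons nth_rcons -/(size (cyclic_bits w')).
  rewrite -[size _]/(size (cyclic_bits w')).-1 size_cyclic_bits // sw'.
  case: ltngtP => [lti|gti|ei].
  - by rewrite modn_small //; move: lti; lia.
  - by move: gti hi; lia.
  - by rewrite ei prednK // modnn /= sw'.
apply/idP/imfsetP => [|[i]].
  rewrite mem_cPeak // sw' => /andP[/andP[j0 jn] hj].
  case: j j0 jn hj => // j _ jn hj.
  (* position j.+1 comes from j, except that position 1 comes from the length *)
  exists (if j == 0 then size w else j).
    rewrite /= mem_cPeak //; case: eqP => [j00|/eqP nj0].
      by subst j; rewrite w0 leqnn modnn nth_bits.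
    by rewrite (modn_small jn) (nth_bits _ jn) hj (ltnW jn) lt0n nj0.
  by case: eqP => [->|_]; rewrite ?modnn // modn_small.
rewrite /= mem_cPeak // => /andP[/andP[i0 iw] hi] ->.
have im : i %% size w < size w by rewrite ltn_mod.
by rewrite mem_cPeak // sw' /= im -nth_bits.
Qed.

(** * The four cases of the rotation *)

(** The four cases with their side conditions expressed by heights, and with all
images in the form [U :: A ++ D :: nseq i U]. In the last case [U :: R] is the
nonempty initial part that ends on the axis. *)
Inductive rotation : seq bool -> seq bool -> Prop :=
| Rotation1 Q i h : height 0 Q = Some h.+1 ->
    rotation (U :: Q ++ [:: D; D] ++ nseq i U)
             (U :: (D :: Q) ++ D :: nseq i U)
| Rotation2 Q i h : height 0 Q = Some h.+1 ->
    rotation (Q ++ [:: D] ++ nseq i.+1 U ++ [:: D])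
             (U :: (Q ++ [:: D]) ++ D :: nseq i U)
| Rotation3 A i h : height 0 A = Some h ->
    rotation (A ++ [:: U; D] ++ nseq i.+1 U)
             (U :: (A ++ [:: U]) ++ D :: nseq i U)
| Rotation4 R Q i h : height 1 R = Some 0 -> height 0 Q = Some h.+1 ->
    rotation (U :: R ++ [:: U] ++ Q ++ [:: D; D] ++ nseq i U)
             (U :: (U :: R ++ D :: Q) ++ D :: nseq i U).

Lemma rotation_size P w : rotation P w -> size w = size P.
Proof. by case=> *; rewrite /= !size_cat /= ?size_cat /= ?size_cat /= ?size_nseq; lia. Qed.

Lemma rotation_height P w : rotation P w -> height 0 w = height 0 P.
Proof.
case=> [Q i h eQ|Q i h eQ|A i h eA|R Q i h eR eQ];
  rewrite /= ?height_cat ?(heightS eQ) ?(heightS eA) /=.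
- by rewrite eQ.
- by rewrite eQ /= height_cat !height_nseqU.
- by rewrite eA.
- by rewrite (heightS eR) eR /= height_cat (heightS eQ) eQ.
Qed.

Lemma peak_bits_nseqU x i : peak_bits x (nseq i U) = nseq i false.
Proof. by elim: i x => //= i IH x; rewrite andbF IH. Qed.

Lemma cyclic_bitsE v i : cyclic_bits (U :: v ++ D :: nseq i U) =
  (~~ last U v && isSome (height 0 v)) :: peak_bits U v ++ last U v :: nseq i false.
Proof.
rewrite /cyclic_bits cyclic_peakE /= {1}/peak_bits pairmap_cat /= andbT.
by rewrite -/(peak_bits D (nseq i U)) peak_bits_nseqU.
Qed.

(** [U :: R] returns to the axis, so [R] alone falls below it, and the last step
to the axis is a down step. *)
Lemma excursion_tail R : height 1 R = Some 0 -> height 0 R = None /\ last U R = D.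
Proof.
move=> eR; split.
  by case e0: (height 0 R) => [m|] //; move: eR; rewrite (heightS e0).
elim/last_ind: R eR => [|R x _] //; rewrite -cats1 height_cat last_cat.
by case: (height 1 R) => //= m; case: x.
Qed.

(** In each case both words are computed by [cyclic_bitsE]. A word [Q] that ends at
positive height starts with [U], so replacing the letter before it creates or
destroys no peak there. *)
Lemma rotation_bits P w : rotation P w -> rot 1 (cyclic_bits w) = cyclic_bits P.
Proof.
case=> [Q i h eQ|Q i h eQ|A i h eA|R Q i h eR eQ].
- rewrite -[[:: D; D] ++ _]/([:: D] ++ D :: nseq i U) catA !cyclic_bitsE.
  case: Q eQ => [|[] Q] //= eQ.
  rewrite rot1_cons /= !last_cat height_cat eQ /= /peak_bits pairmap_cat /=.
  by rewrite !andbT !andbF rcons_cat rcons_cons rcons_nseq -catA.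
- case: Q eQ => [|[] Q] // eQ.
  rewrite [in RHS]cat_cons -[[:: D] ++ _]/((D :: nseq i.+1 U) ++ D :: nseq 0 U).
  rewrite [in RHS]catA !cyclic_bitsE rot1_cons !last_cat height_cat eQ.
  rewrite /peak_bits !pairmap_cat /= -/(peak_bits true (nseq i U)) peak_bits_nseqU.
  have -> : last U (nseq i U) = U by elim: (i).
  by rewrite /= -cats1 -!catA.
- rewrite -[[:: U; D] ++ _]/([:: U] ++ D :: nseq i.+1 U) catA.
  case: A eA => [|[] A] // eA; first by
     rewrite (cyclic_bitsE [:: U] i) (cyclic_bitsE [::] i.+1) rot1_cons /= rcons_nseq.
  rewrite [in RHS]cat_cons !cyclic_bitsE rot1_cons !last_cat /= /peak_bits !pairmap_cat /=.
  by rewrite andbF rcons_cat rcons_cons rcons_nseq.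
- rewrite -[[:: D; D] ++ _]/([:: D] ++ D :: nseq i U) !catA !cyclic_bitsE.
  case: Q eQ => [|[] Q] //= eQ.
  rewrite rot1_cons /= !last_cat !height_cat eR /= /peak_bits !pairmap_cat /=.
  have [eR0 lR] := excursion_tail eR.
  rewrite !last_cat eR0 lR /= !andbF andbT rcons_cat rcons_cons rcons_nseq.
  by rewrite -!catA.
Qed.

(** Two equal images have equal words [A]; its height and its first and last
letters exclude that they come from different cases. *)
Lemma rotation_inj P1 P2 w : rotation P1 w -> rotation P2 w -> P1 = P2.
Proof.
have dec v1 i1 v2 i2 :
  U :: v1 ++ D :: nseq i1 U = U :: v2 ++ D :: nseq i2 U -> v1 = v2 /\ i1 = i2.
  by case=> /last_down_inj.
case=> [Q1 i1 h1 e1|Q1 i1 h1 e1|Q1 i1 h1 e1|R1 Q1 i1 h1 f1 e1];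
  move ew: (U :: _ ++ D :: _) => w1 r2;
  case: r2 ew => [Q2 i2 h2 e2|Q2 i2 h2 e2|Q2 i2 h2 e2|R2 Q2 i2 h2 f2 e2] /dec[ev ->];
  have e0 := congr1 (height 0) ev; have el := congr1 (last U) ev.
all: rewrite /= ?height_cat ?e1 ?e2 ?f1 ?f2 ?last_cat /= in e0 el => //.
- by case: ev => ->.
- by move: ev; rewrite !cats1 => /rcons_inj[->].
- by move: ev; rewrite !cats1 => /rcons_inj[->].
- by case: ev => /(first_return_uniq f1 f2)[-> ->].
Qed.

(** The case is read off from the letters around the last [D]. If these are an up
step before it and nothing after it, the second down step is needed: it precedes
the run of up steps and thus gives the shape of the second case. *)
Lemma rotation_exists P h : height 0 P = Some h -> 1 < count_mem D P ->
  exists w, rotation P w.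
Proof.
move=> eP cD; have inD : D \in P by rewrite -has_pred1 has_count; lia.
have [v [i eq_P]] := last_down_split inD; subst P.
have inDv : D \in v.
  by rewrite -has_pred1 has_count; move: cD; rewrite count_cat /= count_nseq /=; lia.
case/lastP: v inDv eP {cD inD} => // v x; rewrite -cats1 -catA; case: x => inDv eP.
  case: i eP => [|i] eP; last first.
    move: eP; rewrite height_cat; case ev: (height 0 v) => [m|] // _.
    by eexists; apply: (Rotation3 i ev).
  have [Q [[|j] eQ]] := last_down_split inDv.
    by move/(congr1 (last U)): eQ; rewrite !last_cat.
  have ev : v = Q ++ D :: nseq j U.
    by move: eQ; rewrite -rcons_nseq -rcons_cons -rcons_cat cats1 => /rcons_inj[].
  exists (U :: (Q ++ [:: D]) ++ D :: nseq j U).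
  rewrite catA eQ -catA in eP *.
  move: eP; rewrite height_cat; case eh: (height 0 Q) => [[|m]|] // _.
  exact: (Rotation2 j eh).
move: eP; rewrite height_cat; case ev: (height 0 v) => [[|[|m]]|] //= _.
have [R [Q [-> eR eQ]]] := last_return_split ev.
rewrite -catA; case: R eR => [|[] R] //= eR.
  by eexists; apply: (Rotation1 i eQ).
by eexists; apply: (Rotation4 i eR eQ).
Qed.

Lemma penultimate_cPeakE v x i :
  ((size (rcons v x ++ D :: nseq i U)).-1 \in cPeak (rcons v x ++ D :: nseq i U))
  = (i == 0) && x.
Proof.
set P := rcons v x ++ _.
have sP : size P = (size v + i).+2.
  by rewrite size_cat size_rcons /= size_nseq addSn addnS.
rewrite mem_cPeakE sP /= (_ : _ == _ = false) ?ltnSn /=; last by lia.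
rewrite /step /= !nth_cat size_rcons.
case: i @P sP => [|i] P sP.
  by rewrite addn0 ltnSn ltnn subnn /= nth_rcons ltnn eqxx eqb_id andbT.
have -> : ((size v + i.+1).+1 < (size v).+1) = false by lia.
have -> : (size v + i.+1).+1 - (size v).+1 = i.+1 by lia.
rewrite [X in _ && (X == D)](_ : _ = U) ?andbF //.
by rewrite -[LHS]/(nth U (nseq i.+1 U) i) nth_nseq ltnSn.
Qed.

Lemma rho_rel_rotation P w h : height 0 P = Some h -> 1 < count_mem D P ->
  rho_rel P w <-> rotation P w.
Proof.
move=> eP cD; split=> r; case: r eP cD => {P w}.
- move=> P Q i peak nQ defP eP cD; subst P; move: peak nQ; rewrite -[[:: U] ++ _]/(U :: Q ++ [:: D] ++ D :: nseq i U).
  rewrite catA cyclic_peakE nonneg_pathE height_cat.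
  case eQ: (height 0 Q) => [[|m]|]; rewrite ?andbF //= => _ _.
  by rewrite -catA; apply: (Rotation1 i eQ).
- move=> P Q i _ _ -> + cD; rewrite height_cat.
  case eQ: (height 0 Q) => [[|m]|] //= _.
  have := Rotation2 i eQ; rewrite -catA; exact.
- move=> P Q _ _ lastU defP eP cD; subst P.
  have inDQ : D \in Q.
    by rewrite -has_pred1 has_count; move: cD; rewrite count_cat /=; lia.
  have [v [i eQ]] := last_down_split inDQ; rewrite {}eQ -catA /= cats1 rcons_nseq in lastU eP *.
  (* v is not empty: otherwise step 0 would read the first letter, which is D *)
  move: lastU; rewrite lastDE; case/lastP: v eP => [|v x] // eP.
  rewrite size_rcons /step /= nth_cat size_rcons ltnSn nth_rcons ltnn eqxx => ex; subst x.
  move: eP; rewrite -cats1 -catA height_cat; case ev: (height 0 v) => [m|] // _.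
  have := Rotation3 i ev; rewrite -catA; exact.
- move=> P R Q i _ peak _ nR bR nQ defP eP _; subst P; move: peak eP.
  have /height0P eR : nonneg_path R && ends_at 0 R by rewrite nR.
  move: nQ; rewrite nonneg_pathE; case eQ: (height 0 Q) => [m|] // _ peak.
  rewrite !height_cat eR /= height_cat (heightS eQ) /=.
  case: m eQ => // m eQ _.
  case: R eR peak {nR bR} => [|[] R] //= eR peak; last first.
    by have := Rotation4 i eR eQ; rewrite /= -catA.
  have := cyclic_peakE (Q ++ [:: D]) i; rewrite -catA (negbTE peak).
  by rewrite last_cat height_cat eQ.
- move=> Q i m eQ _ _; apply: Rho1 => //; last by rewrite nonneg_pathE eQ.
  rewrite -[[:: D; D] ++ _]/([:: D] ++ D :: nseq i U) catA cyclic_peakE.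
  by rewrite last_cat height_cat eQ.
- move=> Q i m eQ _ _; rewrite -catA; apply: (@Rho2 _ Q i) => //; last by rewrite nonneg_pathE eQ.
  have := penultimate_cPeakE (Q ++ D :: nseq i U) U 0.
  by rewrite rcons_cat rcons_cons rcons_nseq -catA => ->.
- move=> A i m eA _ _.
  have eP : A ++ [:: U; D] ++ nseq i.+1 U = rcons A U ++ D :: nseq i.+1 U by rewrite cat_rcons.
  rewrite -catA; apply: (@Rho3 _ (A ++ [:: U, D & nseq i U])); rewrite eP.
  + by rewrite penultimate_cPeakE.
  + case: A eA {eP} => [|[] A] // eA; first by rewrite (cyclic_peakE [::]).
    by rewrite rcons_cons cat_cons cyclic_peakE last_rcons.
  + by rewrite lastDE size_rcons /step /= nth_cat size_rcons ltnSn nth_rcons ltnn eqxx.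
  + by rewrite cat_rcons -catA /= cats1 rcons_nseq.
- move=> R Q i m eR eQ _ _.
  have [eR0 lR] := excursion_tail eR.
  set P := U :: R ++ _.
  have eP : P = U :: (R ++ U :: Q ++ [:: D]) ++ D :: nseq i U by rewrite /P -!catA /= -!catA.
  have eP' : P = rcons (U :: R ++ U :: Q) D ++ D :: nseq i U by rewrite /P -cats1 -!catA /= -!catA.
  rewrite cat_cons -catA; apply: (@Rho4 _ (U :: R) Q i) => //.
  + by rewrite eP' penultimate_cPeakE andbF.
  + by rewrite eP cyclic_peakE height_cat eR0 andbF.
  + by rewrite eP' lastDE size_rcons /step /= nth_cat size_rcons ltnSn nth_rcons ltnn eqxx.
  + by rewrite nonneg_pathE /= eR.
  + by have /height0P/andP[] : height 0 (U :: R) = Some 0 by [].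
  + by rewrite nonneg_pathE eQ.
Qed.

(** * Cyclic descents of two-row tableaux *)

Definition positions b w := [seq j <- iota 1 (size w) | step w j == b].

Lemma mem_positions b w x : (x \in positions b w) = (0 < x <= size w) && (step w x == b).
Proof. by rewrite mem_filter mem_iota add1n ltnS andbC. Qed.

Lemma positions_sorted b w : sorted ltn (positions b w).
Proof. by apply: sorted_filter (iota_ltn_sorted _ _); exact: ltn_trans. Qed.

Lemma size_positions b w : size (positions b w) = count_mem b w.
Proof.
rewrite -[w in RHS]take_size -count_le_filter //; apply/esym/eqP.
by rewrite -all_count; apply/allP => x; rewrite mem_positions => /andP[/andP[]].
Qed.

Lemma positions_last_down v i :
  positions D (v ++ D :: nseq i U) = rcons (positions D v) (size v).+1.
Proof.
rewrite /positions size_cat iotaD filter_cat /= size_nseq add1n /step.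
rewrite nth_cat ltnn subnn /= -cats1; congr (_ ++ _ :: _).
  apply: eq_in_filter => x; rewrite mem_iota add1n => /andP[x0 xv].
  by rewrite nth_cat ifT //; move: x0 xv; lia.
apply/eqP; rewrite -(negbK (_ == _)) -has_filter; apply/hasPn => x.
rewrite mem_iota => /andP[lex _]; rewrite nth_cat ifF; last by move: lex; lia.
case ed: (x.-1 - size v) => [|d] /=; first by move: lex ed; lia.
by rewrite nth_nseq; case: ifP.
Qed.

Lemma count_le_nth s j : sorted ltn s -> j < size s ->
  count (fun x => x <= nth 0 s j) s = j.+1.
Proof.
move=> ss js; apply/eqP; rewrite eqn_leq sorted_count_le // leqnn andbT.
rewrite leqNgt; apply/negP => lt_jc.
have lt_j1s : j.+1 < size s by apply: leq_trans lt_jc (count_size _ _).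
by move: lt_jc; rewrite sorted_count_le // leqNgt (sorted_ltn_nth ltn_trans) // ltnSn.
Qed.

(** After the [j]-th down step (counted from 0), [j.+1] steps are down and at least
as many are up; the path is on the axis if the up step number [j.+1] is still to
come. *)
Lemma is_return_entry w j : nonneg_path w ->
  j < size (positions D w) -> j.+1 < size (positions U w) ->
  is_return w (nth 0 (positions D w) j) =
  (nth 0 (positions D w) j < nth 0 (positions U w) j.+1).
Proof.
move=> w0 jD jU; set x := nth 0 _ j.
have : x \in positions D w by rewrite mem_nth.
rewrite mem_positions => /andP[/andP[x0 xw] stepx].
rewrite /is_return stepx /ends_at addn0 ltnNge -sorted_count_le ?positions_sorted //.
have := allP w0 x; rewrite mem_iota ltnS xw => /(_ isT).
rewrite -!count_le_filter // -/(positions U w) -/(positions D w).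
by rewrite count_le_nth ?positions_sorted //; lia.
Qed.

(** The last down step is at the last entry of the second row, and it follows
another one exactly when the last two entries are consecutive. In that case the
other down steps correspond to the inequalities between entries, except the last
but one, which cannot be a return since a further down step follows it. *)
Lemma cyclic_descentE w h k : height 0 w = Some h -> count_mem D w = k -> 1 < k ->
  let t := Gamma_inv_rows w in
  (entry t 2 k == (entry t 2 k.-1).+1)
     && all (fun i => entry t 1 i < entry t 2 i.-1) (index_iota 2 k)
  = (size w \in cPeak w).
Proof.
move=> ew cD k1 /=; rewrite mem_size_cPeak.
have inD : D \in w by rewrite -has_pred1 has_count cD; lia.
have /height0P/andP[w0 endw] := ew.
rewrite /entry /Gamma_inv_rows /= -/(positions D w) -/(positions U w).
have szD := size_positions D w; rewrite cD in szD.
have szU : k <= size (positions U w) by rewrite size_positions -cD (eqP endw) leq_addr.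
have [v [i ev]] := last_down_split inD; rewrite [in lastD w]ev lastDE /=.
have eD := positions_last_down v i; rewrite -ev in eD.
have szv : (size (positions D v)).+1 = k by rewrite -szD eD size_rcons.
have stepv x : x <= size v -> 0 < x -> step w x = step v x.
  by case: x => // x xv _; rewrite ev !stepS nth_cat xv.
have nth_last : nth 0 (positions D w) k.-1 = (size v).+1.
  by rewrite eD nth_rcons -szv /= ltnn eqxx.
have nth_v j : j < k.-1 -> nth 0 (positions D w) j = nth 0 (positions D v) j.
  by move=> jk; rewrite eD nth_rcons ifT //; lia.
have mem_v j : j < k.-1 -> nth 0 (positions D w) j \in positions D v.
  by move=> jk; rewrite nth_v //; apply: mem_nth; rewrite -ltnS szv; lia.
rewrite nth_last eqSS.
case/lastP: v ev eD szv stepv nth_last nth_v mem_v => [|v x] ev eD szv stepv nth_last nth_v mem_v.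
  by move: k1; rewrite -szv.
rewrite size_rcons in nth_last stepv *.
have -> : step w (size v).+1 = x.
  by rewrite stepv ?size_rcons // stepS nth_rcons ltnn eqxx.
case: x => /= in ev eD szv stepv nth_last nth_v mem_v *.
  apply/negbTE; rewrite negb_and; apply/orP; left.
  apply/eqP => e; have := mem_v k.-2; rewrite -e mem_positions stepS size_rcons.
  by rewrite nth_rcons ltnn eqxx andbF => /(_ ltac:(lia)).
have nth_pen : nth 0 (positions D w) k.-2 = (size v).+1.
  rewrite nth_v; last by lia.
  have := positions_last_down v 0; rewrite cats1 => eDv.
  move: szv; rewrite eDv size_rcons nth_rcons => <-.
  by rewrite /= ltnn eqxx.
rewrite nth_pen eqxx andTb -[_ || _]/(has (is_return w) (iota 1 (size v).+1)) -all_predC.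
have no_return : is_return w (size v).+1 = false.
  apply/negbTE/negP => /andP[_]; rewrite ev takel_cat ?size_rcons // take_oversize ?size_rcons // => bal.
  have nn : nonneg_path (rcons v D).
    by move: ew; rewrite ev height_cat nonneg_pathE; case: (height 0 _).
  have /height0P e0 : nonneg_path (rcons v D) && ends_at 0 (rcons v D) by rewrite nn.
  by move: ew; rewrite ev height_cat e0.
apply/allP/allP => H x.
  rewrite mem_iota add1n ltnS => /andP[x0 xv]; apply/negP => ret.
  have xD : x \in positions D w.
    rewrite mem_positions x0; case/andP: ret => -> _; rewrite andbT.
    by rewrite ev size_cat size_rcons; lia.
  have jk : index x (positions D w) < k by rewrite -szD index_mem.
  set j := index x _ in jk; have ex : nth 0 (positions D w) j = x by rewrite nth_index.
  case: (ltnP j k.-2) => [lt_j|ge_j].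
    have := H j.+2; rewrite mem_index_iota /= => /(_ ltac:(lia)).
    move=> lt_UD; move: ret; rewrite -ex is_return_entry ?szD //.
      by rewrite ltnNge (ltnW lt_UD).
    by apply: leq_trans szU; move: lt_j; lia.
  have ej : j = k.-2 \/ j = k.-1 by lia.
  case: ej => ej; rewrite ej ?nth_pen ?nth_last in ex.
    by move: ret; rewrite -ex no_return.
  by move: xv; rewrite -ex ltnn.
rewrite mem_index_iota => /andP[x2 xk]; case: x x2 xk => [|[|j]] // _ jk /=.
have := mem_v j ltac:(lia); rewrite mem_positions size_rcons => /andP[/andP[j0 jv] st].
have := H (nth 0 (positions D w) j); rewrite mem_iota j0 add1n ltnS jv => /(_ isT).
have lt_jU : j.+1 < size (positions U w) := leq_trans (ltnW jk) szU.
rewrite [predC _ _]/= is_return_entry ?szD ?(ltnW (ltnW jk)) //.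
rewrite -leqNgt leq_eqVlt => /orP[/eqP e|//].
have : nth 0 (positions U w) j.+1 \in positions U w by exact: mem_nth.
by rewrite e mem_positions stepv ?size_rcons // (eqP st) andbF.
Qed.

Lemma row_of_Gamma_inv w x : 0 < x <= size w ->
  row_of (Gamma_inv_rows w) x = ~~ step w x.
Proof.
move=> hx; rewrite /row_of /= -/(positions U w) -/(positions D w) !mem_positions hx /=.
by case: (step w x).
Qed.

Lemma count_down_path n k (hkn : k.*2 <= n) (P : Path n (n - k.*2)) :
  count_mem D P = k.
Proof.
by rewrite -size_positions; have /and4P[/eqP[_ ->]] := Gamma_inv_subproof hkn P.
Qed.

Lemma cDes_Gamma_inv n k (hk : 1 < k) (hkn : k.*2 <= n) (P : Path n (n - k.*2)) :
  cDes (Gamma_inv hkn P) = cPeak P.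
Proof.
case: P => -[w sw] hw; rewrite /cDes /= /word /=.
have /height0P ew : nonneg_path w && ends_at (n - k.*2) w by [].
have szw := eqP sw.
have cD : count_mem D w = k := count_down_path hkn (exist _ (Tuple sw) hw).
rewrite (cyclic_descentE ew cD hk) szw /Des.
have -> : [fset i in iota 1 n.-1 | row_of (Gamma_inv_rows w) i < row_of (Gamma_inv_rows w) i.+1]%fset =
          [fset i in iota 1 n.-1 | (step w i == U) && (step w i.+1 == D)]%fset.
  apply/fsetP => i; rewrite !inE; apply: andb_id2l; rewrite mem_iota => hi.
  rewrite !row_of_Gamma_inv ?szw; try lia.
by have := mem_size_cPeak w; rewrite /cPeak szw => ->.
Qed.

(** * The rotation as a bijection *)

HB.instance Definition _ n h :=
  Finite.copy (Path n h) {w : n.-tuple bool | nonneg_path w && ends_at h w}.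

Lemma word_inj n h : injective (@word n h).
Proof. by move=> P P' e; apply/val_inj/val_inj. Qed.

Lemma height_word n h (P : Path n h) : height 0 P = Some h.
Proof. by apply/height0P; exact: (valP P). Qed.

Lemma word_surj n h w : size w = n -> height 0 w = Some h ->
  exists P : Path n h, word P = w.
Proof.
move=> /eqP sw /height0P hw.
by exists (exist (fun w : n.-tuple bool => nonneg_path w && ends_at h w) (Tuple sw) hw).
Qed.

Theorem mainTheorem11 (n k : nat) (hk : 1 < k) (hkn : k.*2 <= n) :
  exists rho : Path n (n - k.*2) -> Path n (n - k.*2),
    [/\ forall (P : Path n (n - k.*2)) (w : seq bool),
          rho_rel P w <-> w = rho P,
        bijective rho,
        forall P : Path n (n - k.*2), cPeak (rho P) = cyc_shift n (cPeak P)
      & let phi := Gamma_inv hkn \o rho \o Gamma hkn in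
        bijective phi /\
        forall T : SYT [:: n - k; k], cDes (phi T) = cyc_shift n (cDes T)].
Proof.
have size_word (P : Path n (n - k.*2)) : size P = n by rewrite /word size_tuple.
have downs (P : Path n (n - k.*2)) : 1 < count_mem D P by rewrite (count_down_path hkn).
have rotP (P : Path n (n - k.*2)) w := rho_rel_rotation w (height_word P) (downs P).
have path_of (P : Path n (n - k.*2)) w : rotation P w ->
    exists P' : Path n (n - k.*2), word P' = w.
  move=> rPw; apply: word_surj; first by rewrite (rotation_size rPw) size_word.
  by rewrite (rotation_height rPw) height_word.
have ex_rho (P : Path n (n - k.*2)) : exists P' : Path n (n - k.*2), rotation P P'.
  have [w rPw] := rotation_exists (height_word P) (downs P).
  by have [P' eP'] := path_of _ _ rPw; exists P'; rewrite eP'.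
have [rho rhoP] := fin_all_exists ex_rho.
have rho_bij : bijective rho.
  apply: injF_bij => P1 P2 e; apply: word_inj; apply: rotation_inj (rhoP P1) _.
  by rewrite e.
have rho_shift (P : Path n (n - k.*2)) : cPeak (rho P) = cyc_shift n (cPeak P).
  have := @cPeak_shift P (rho P); rewrite !size_word; apply=> //; first by lia.
  exact: rotation_bits.
exists rho; split=> //.
- move=> P w; rewrite rotP; split=> [rPw|->]; last exact: rhoP.
  (* w is also the image under rho of some P', and then P' = P by injectivity. *)
  have [W eW] := path_of _ _ rPw; have [rho' _ rho'K] := rho_bij.
  pose P' : Path n (n - k.*2) := rho' W.
  have rP' : rotation P' w by have := rhoP P'; rewrite /P' rho'K eW.
  by rewrite (word_inj (rotation_inj rPw rP')) /P' rho'K eW.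
- split.
    apply: bij_comp; last by exists (Gamma_inv hkn); [exact: GammaK | exact: Gamma_invK].
    by apply: bij_comp => //; exists (Gamma hkn); [exact: Gamma_invK | exact: GammaK].
  by move=> T; rewrite /= cDes_Gamma_inv // rho_shift -{2}(GammaK hkn T) cDes_Gamma_inv.
Qed.
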